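(* Let $V^*$ be the solution of the HJB equation $$0=q+(\nabla_xV)^Tf-\tfrac12(\nabla_xV)^TGR^{-1}G^T(\nabla_xV)+\tfrac12\mathrm{Tr}((\nabla_{xx}V)B\Sigma_\epsilon B^T)\ \text{ on }\Omega,\qquad V=\phi\ \text{ on }\partial\Omega.$$ Let $\Psi_l,\Psi_u$ be smooth functions on $\Omega$ with $\frac1\lambda q\Psi_l-\mathcal{L}(\Psi_l)\le0$ on $\Omega$, $\Psi_l\le\psi$ on $\partial\Omega$, and $\frac1\lambda q\Psi_u-\mathcal{L}(\Psi_u)\ge0$ on $\Omega$, $\Psi_u\ge\psi$ on $\partial\Omega$. Put $V_u=-\lambda\log\Psi_l$ and $V_l=-\lambda\log\Psi_u$. Then $V_u\ge V^*$ and $V_l\le V^*$ on $\Omega$.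
   Context: Setting. $\Omega=\{x\in\mathbb{R}^n: g_i(x)\ge 0,\ i=1,\dots,k\}$ with $g_i\in\mathbb{R}[x]$ is a compact basic closed semialgebraic set, $0\in\Omega$, and its boundary is described by polynomials, $\partial\Omega=\{x:\prod_{i=1}^m h_i(x)=0\}$, $h_i\in\mathbb{R}[x]$. The dynamics are $dx_t=(f(x_t)+G(x_t)u_t)\,dt+B(x_t)\,d\omega_t$ with $f,G,B$ having real polynomial entries ($f\in\mathbb{R}^n[x]$, $G\in\mathbb{R}^{n\times m'}[x]$, $B\in\mathbb{R}^{n\times l}[x]$), $f(0)=0$, $G(0)=0$, $B(0)=0$, and $\omega_t$ an $l$-dimensional Brownian motion with covariance $\Sigma_\epsilon$. The cost is $J(x,u)=\mathbb{E}_{\omega_t}[\phi(x_T)+\int_0^T q(x_t)+\frac12u_t^TRu_t\,dt]$, where $T$ is the first time the state reaches the boundary of the domain or the origin, $R$ is a symmetric positive definite matrix, and $\phi,q$ are nonnegative polynomials, positive definite on $\Omega$ (zero at $0$, positive on $\Omega\setminus\{0\}$). The origin is treated as part of the boundary on which boundary data are imposed: $\phi(0)=0$, and $\phi>0$ on $\partial\Omega\setminus\{0\}$. There is $\lambda>0$ with $\lambda G(x)R^{-1}G(x)^T=B(x)\Sigma_\epsilon B(x)^T=:\Sigma(x)$ (also written $\Sigma_t$). Notation. $\mathcal{L}(\Psi)=f^T\nabla_x\Psi+\frac12\mathrm{Tr}((\nabla_{xx}\Psi)\Sigma)$ and $\psi(x)=e^{-\phi(x)/\lambda}$ on $\partial\Omega$.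 It is assumed throughout that there are unique nontrivial viscosity solutions $V^*$ of the HJB equation in the claim and $\Psi^*$ of the linear equation $0=-\frac1\lambda q\Psi+\mathcal{L}(\Psi)$ on $\Omega$, $\Psi=\psi$ on $\partial\Omega$, and they are related by $V^*=-\lambda\log\Psi^*$. The functions $\Psi_l,\Psi_u$ are understood to be positive where their logarithms are taken. *)

(* Defs.v *)
From HB Require Import structures.
From mathcomp Require Import all_boot all_order all_algebra.
From mathcomp Require mpoly.
From mathcomp Require Import all_classical all_reals all_analysis.

Set Implicit Arguments.
Unset Strict Implicit.
Unset Printing Implicit Defensive.

Import Order.TTheory GRing.Theory Num.Theory.
Import numFieldNormedType.Exports.

Local Open Scope classical_set_scope.
Local Open Scope ring_scope.

(* Points of R^n are column vectors ['cV[R]_n].  [mpoly] is not imported because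
   its notations clash with those of MathComp-Analysis. *)

Definition mpol (R : realType) (n : nat) := mpoly.mpoly n R.

Section matrices.
Variable R : realType.

Definition dotmx n (u v : 'cV[R]_n) : R := (u^T *m v) ord0 ord0.

Definition symmetric_posdef n (A : 'M[R]_n) : Prop :=
  A^T = A /\ forall v : 'cV[R]_n, v != 0 -> 0 < dotmx v (A *m v).

Definition covariance_mx n (A : 'M[R]_n) : Prop :=
  A^T = A /\ forall v : 'cV[R]_n, 0 <= dotmx v (A *m v).

End matrices.

Section polynomials.
Variables (R : realType) (n : nat).

Definition peval (p : mpol R n) (x : 'cV[R]_n) : R :=
  mpoly.meval (fun i => x i ord0) p.

Definition pevalmx a b (A : 'M[mpol R n]_(a, b)) (x : 'cV[R]_n) : 'M[R]_(a, b) :=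
  map_mx (fun p => peval p x) A.

Definition basic_semialgebraic k (g : 'I_k -> mpol R n) : set 'cV[R]_n :=
  [set x | forall i, 0 <= peval (g i) x].

Definition product_zeros m (h : 'I_m -> mpol R n) : set 'cV[R]_n :=
  [set x | \prod_(i < m) peval (h i) x = 0].

Definition nonneg_posdef_on (Omega : set 'cV[R]_n) (p : mpol R n) : Prop :=
  [/\ forall x, 0 <= peval p x,
      peval p 0 = 0
    & forall x, Omega x -> x != 0 -> 0 < peval p x].

End polynomials.

Section calculus.
Variables (R : realType) (n : nat).
Implicit Types (u : 'cV[R]_n -> R) (U : set 'cV[R]_n).

Definition basis_vec (i : 'I_n) : 'cV[R]_n := delta_mx i ord0.

Definition partial (i : 'I_n) u : 'cV[R]_n -> R :=
  fun x => 'D_(basis_vec i) u x.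

Definition iter_partial (s : seq 'I_n) u : 'cV[R]_n -> R := foldr partial u s.

Definition grad u (x : 'cV[R]_n) : 'cV[R]_n := \col_i partial i u x.

Definition hessian u (x : 'cV[R]_n) : 'M[R]_n :=
  \matrix_(i, j) partial i (partial j u) x.

(* The conditions determine [u] as a C^k function only when [U] is open. *)
Definition Ck_on (k : nat) U u : Prop :=
  forall s : seq 'I_n, (size s <= k)%N -> forall x, U x ->
    {for x, continuous (iter_partial s u)} /\
    ((size s < k)%N -> forall i, derivable (iter_partial s u) x (basis_vec i)).

(* A function is smooth on an arbitrary set when it is C^infinity on some open
   neighbourhood of that set. *)
Definition smooth_on (A : set 'cV[R]_n) u : Prop :=
  exists U, [/\ open U, A `<=` U & forall k, Ck_on k U u].

End calculus.

Section viscosity.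
Variables (R : realType) (n : nat).
Implicit Types (Omega bd O : set 'cV[R]_n) (u data : 'cV[R]_n -> R).

Definition topological_boundary Omega : set 'cV[R]_n :=
  closure Omega `\` interior Omega.

(* The set on which boundary data are imposed: the origin is included. *)
Definition data_boundary Omega : set 'cV[R]_n :=
  topological_boundary Omega `|` [set 0].

(* The second-order equation F(x, u, Du, D^2u) = 0, with F nonincreasing in the
   Hessian argument (the sign convention of Crandall, Ishii and Lions). *)
Implicit Type F : 'cV[R]_n -> R -> 'cV[R]_n -> 'M[R]_n -> R.

Definition viscosity_subsolution F O u : Prop :=
  forall (v : 'cV[R]_n -> R) (x : 'cV[R]_n), Ck_on 2 O v -> O x ->
    (\forall y \near x, u y - v y <= u x - v x) ->
    F x (u x) (grad v x) (hessian v x) <= 0.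

Definition viscosity_supersolution F O u : Prop :=
  forall (v : 'cV[R]_n -> R) (x : 'cV[R]_n), Ck_on 2 O v -> O x ->
    (\forall y \near x, u x - v x <= u y - v y) ->
    0 <= F x (u x) (grad v x) (hessian v x).

(* For closed [Omega], the equation is imposed on the open set
   [Omega `\` data_boundary Omega]. *)
Definition viscosity_solution F Omega data u : Prop :=
  [/\ {within Omega, continuous u},
      viscosity_subsolution F (Omega `\` data_boundary Omega) u,
      viscosity_supersolution F (Omega `\` data_boundary Omega) u
    & forall x, data_boundary Omega x -> u x = data x].

Definition nontrivial_on Omega u : Prop := exists2 x, Omega x & u x != 0.

Definition unique_nontrivial_viscosity_solution F Omega data u : Prop :=
  [/\ viscosity_solution F Omega data u,
      nontrivial_on Omega u
    & forall w, viscosity_solution F Omega data w -> nontrivial_on Omega w ->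
        forall x, Omega x -> w x = u x].

End viscosity.

Section control.
Variables (R : realType) (n mu l : nat).
Variables (f : 'cV[mpol R n]_n) (G : 'M[mpol R n]_(n, mu)).
Variables (B : 'M[mpol R n]_(n, l)) (Sigma_eps : 'M[R]_l) (Rc : 'M[R]_mu).
Variables (phi q : mpol R n) (lam : R).

Definition control_mx (x : 'cV[R]_n) : 'M[R]_n :=
  pevalmx G x *m invmx Rc *m (pevalmx G x)^T.

Definition noise_mx (x : 'cV[R]_n) : 'M[R]_n :=
  pevalmx B x *m Sigma_eps *m (pevalmx B x)^T.

Definition hjb_operator (x : 'cV[R]_n) (r : R) (p : 'cV[R]_n) (X : 'M[R]_n) : R :=
  - (peval q x + dotmx p (pevalmx f x)
     - 2^-1 * dotmx p (control_mx x *m p)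
     + 2^-1 * \tr (X *m noise_mx x)).

Definition generator (x p : 'cV[R]_n) (X : 'M[R]_n) : R :=
  dotmx (pevalmx f x) p + 2^-1 * \tr (X *m noise_mx x).

Definition linear_operator (x : 'cV[R]_n) (r : R) (p : 'cV[R]_n) (X : 'M[R]_n) : R :=
  lam^-1 * peval q x * r - generator x p X.

Definition Lop (Psi : 'cV[R]_n -> R) (x : 'cV[R]_n) : R :=
  generator x (grad Psi x) (hessian Psi x).

Definition desirability_data (x : 'cV[R]_n) : R := expR (- (peval phi x / lam)).

Definition log_value (Psi : 'cV[R]_n -> R) (x : 'cV[R]_n) : R :=
  - lam * ln (Psi x).

End control.

(* Main.v *)
Require Import Defs.
From HB Require Import structures.
From mathcomp Require Import all_boot all_order all_algebra.
From mathcomp Require mpoly.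
From mathcomp Require Import all_classical all_reals all_analysis.

Set Implicit Arguments.
Unset Strict Implicit.
Unset Printing Implicit Defensive.

Import Order.TTheory GRing.Theory Num.Theory.
Import numFieldNormedType.Exports.

Local Open Scope classical_set_scope.
Local Open Scope ring_scope.

(** Take the difference between a smooth sub- or supersolution of the linear
    equation and the viscosity solution [Psistar], and let it be extremal over
    the compact set [Omega] at [x0].  If the comparison failed, the boundary
    inequalities would force [x0] to be off the boundary and different from the
    origin.  The smooth function is then itself an admissible test function for
    [Psistar] at [x0], so the definition of viscosity solution and the classical
    inequality of the smooth function speak of the same gradient and the same
    Hessian, and differ only in the zeroth-order term
    [lam^-1 * q(x0) * r].  As [q(x0) > 0] away from the origin, this orders the
    two values at [x0], a contradiction ([classical_subsolution_le] and
    [classical_supersolution_ge]).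

    Hence [Psi_l <= Psistar <= Psi_u] on [Omega], and since [Psi_l] is positive,
    [- lam * ln] reverses these inequalities and turns [Psistar] into [Vstar]. *)

Section smooth_functions.
Variables (R : realType) (n : nat).
Implicit Types (A O : set 'cV[R]_n) (v : 'cV[R]_n -> R).

Lemma smooth_on_continuous A v : smooth_on A v -> {in A, continuous v}.
Proof.
move=> [U [_ AU /(_ 0%N) vU]] x; rewrite inE => Ax.
by have [] := vU [::] (leqnn _) x (AU _ Ax).
Qed.

Lemma smooth_on_Ck A O v k : O `<=` A -> smooth_on A v -> Ck_on k O v.
Proof. by move=> OA [U [_ AU vU]] s sk x Ox; apply: vU => //; exact/AU/OA. Qed.

Lemma not_topological_boundary A x :
  A x -> ~ topological_boundary A x -> interior A x.
Proof.
move=> Ax xbd; apply: contrapT => xint; apply: xbd; split => //.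
exact: subset_closure.
Qed.

End smooth_functions.

Section comparison.
Variables (R : realType) (n : nat).
Variables (F : 'cV[R]_n -> R -> 'cV[R]_n -> 'M[R]_n -> R).
Variables (Omega : set 'cV[R]_n) (data w v : 'cV[R]_n -> R).
Hypothesis Omega_compact : compact Omega.
Hypothesis F_increasing : forall x r s p X, (Omega `\` data_boundary Omega) x ->
  r < s -> F x r p X < F x s p X.
Hypothesis w_solution : viscosity_solution F Omega data w.
Hypothesis v_smooth : smooth_on Omega v.

Let subD : Omega `\` data_boundary Omega `<=` Omega.
Proof. by move=> x []. Qed.

Let near_Omega x : Omega x -> ~ data_boundary Omega x ->
  \forall y \near x, Omega y.
Proof.
by move=> Ox xbd; apply: not_topological_boundary => // xtb; apply: xbd; left.
Qed.

Let diff_continuous : {within Omega, continuous (w - v)}.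
Proof.
have [wc _ _ _] := w_solution.
move=> x; apply: cvgB; first exact: wc.
exact: (continuous_in_subspaceT (smooth_on_continuous v_smooth)).
Qed.

(** At a minimum point of [w - v] the function [v] touches [w] from below, so the
    supersolution property of [w] applies with [v] as test function; a negative
    minimum would contradict the strict monotonicity of [F] in the value of
    the unknown. *)
Lemma classical_subsolution_le :
    (forall x, Omega x -> F x (v x) (grad v x) (hessian v x) <= 0) ->
    (forall x, data_boundary Omega x -> v x <= data x) ->
  forall x, Omega x -> v x <= w x.
Proof.
move=> v_sub v_bd x Ox; have [_ _ w_super w_bd] := w_solution.
have Omega_neq0 : Omega !=set0 by exists x.
have [x0 /set_mem Ox0 x0_min] :=
  compact_EVT_min Omega_neq0 Omega_compact diff_continuous.
suff le0 : v x0 <= w x0.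
  by rewrite -subr_ge0 (le_trans _ (x0_min _ (mem_set Ox)))// subr_ge0.
have [bd|nbd] := pselect (data_boundary Omega x0).
  by rewrite w_bd//; exact: v_bd.
rewrite leNgt; apply/negP => lt_wv.
have := w_super v x0 (smooth_on_Ck subD v_smooth) (conj Ox0 nbd).
have touching : \forall y \near x0, w x0 - v x0 <= w y - v y.
  by near=> y; apply: x0_min; apply/mem_set; near: y; exact: near_Omega.
move=> /(_ touching); apply/negP; rewrite -ltNge.
exact: lt_le_trans (F_increasing _ _ (conj Ox0 nbd) lt_wv) (v_sub _ Ox0).
Unshelve. all: by end_near. Qed.

Lemma classical_supersolution_ge :
    (forall x, Omega x -> 0 <= F x (v x) (grad v x) (hessian v x)) ->
    (forall x, data_boundary Omega x -> data x <= v x) ->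
  forall x, Omega x -> w x <= v x.
Proof.
move=> v_super v_bd x Ox; have [_ w_sub _ w_bd] := w_solution.
have Omega_neq0 : Omega !=set0 by exists x.
have [x0 /set_mem Ox0 x0_max] :=
  compact_EVT_max Omega_neq0 Omega_compact diff_continuous.
suff le0 : w x0 <= v x0.
  by rewrite -subr_le0 (le_trans (x0_max _ (mem_set Ox)))// subr_le0.
have [bd|nbd] := pselect (data_boundary Omega x0).
  by rewrite w_bd//; exact: v_bd.
rewrite leNgt; apply/negP => lt_vw.
have := w_sub v x0 (smooth_on_Ck subD v_smooth) (conj Ox0 nbd).
have touching : \forall y \near x0, w y - v y <= w x0 - v x0.
  by near=> y; apply: x0_max; apply/mem_set; near: y; exact: near_Omega.
move=> /(_ touching); apply/negP; rewrite -ltNge.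
exact: le_lt_trans (v_super _ Ox0) (F_increasing _ _ (conj Ox0 nbd) lt_vw).
Unshelve. all: by end_near. Qed.

End comparison.

(** The strict monotonicity comes from [q], which is positive only away from the
    origin; the origin is removed with the rest of [data_boundary Omega]. *)
Lemma linear_operator_increasing (R : realType) (n l : nat)
    (Omega : set 'cV[R]_n) (f : 'cV[mpol R n]_n) (B : 'M[mpol R n]_(n, l))
    (Sigma_eps : 'M[R]_l) (q : mpol R n) (lam : R) :
    0 < lam -> nonneg_posdef_on Omega q ->
  forall x r s p X, (Omega `\` data_boundary Omega) x -> r < s ->
    linear_operator f B Sigma_eps q lam x r p X <
    linear_operator f B Sigma_eps q lam x s p X.
Proof.
move=> lam_gt0 [_ _ q_gt0] x r s p X [Ox nbd] rs.
rewrite /linear_operator ltrD2r ltr_pM2l// mulr_gt0 ?invr_gt0// q_gt0//.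
by apply/eqP => x0; apply: nbd; right.
Qed.

Lemma ler_log_value (R : realType) (n : nat) (lam : R)
    (Psi Psi' : 'cV[R]_n -> R) (x : 'cV[R]_n) :
  0 <= lam -> 0 < Psi x -> Psi x <= Psi' x ->
  log_value lam Psi' x <= log_value lam Psi x.
Proof.
move=> lam_ge0 Psi_gt0 le_Psi; rewrite /log_value !mulNr lerN2 ler_wpM2l//.
by rewrite ler_ln// posrE (lt_le_trans Psi_gt0).
Qed.

Theorem proposition3p6 (R : realType) (n mu l k m : nat)
    (g : 'I_k -> mpol R n) (h : 'I_m -> mpol R n) (Omega : set 'cV[R]_n)
    (f : 'cV[mpol R n]_n) (G : 'M[mpol R n]_(n, mu)) (B : 'M[mpol R n]_(n, l))
    (Sigma_eps : 'M[R]_l) (Rc : 'M[R]_mu) (phi q : mpol R n) (lam : R)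
    (Vstar Psistar Psi_l Psi_u : 'cV[R]_n -> R)
    (Omega_def : Omega = basic_semialgebraic g)
    (Omega_compact : compact Omega)
    (Omega_0 : Omega 0)
    (Omega_boundary : topological_boundary Omega = product_zeros h)
    (f_0 : pevalmx f 0 = 0) (G_0 : pevalmx G 0 = 0) (B_0 : pevalmx B 0 = 0)
    (Sigma_eps_cov : covariance_mx Sigma_eps)
    (Rc_posdef : symmetric_posdef Rc)
    (phi_posdef : nonneg_posdef_on Omega phi)
    (q_posdef : nonneg_posdef_on Omega q)
    (lam_gt0 : 0 < lam)
    (noise_control : forall x,
       lam *: control_mx G Rc x = noise_mx B Sigma_eps x)
    (Vstar_solution : unique_nontrivial_viscosity_solution
       (hjb_operator f G B Sigma_eps Rc q) Omega (peval phi) Vstar)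
    (Psistar_solution : unique_nontrivial_viscosity_solution
       (linear_operator f B Sigma_eps q lam) Omega
       (desirability_data phi lam) Psistar)
    (Vstar_Psistar : forall x, Omega x -> Vstar x = log_value lam Psistar x)
    (Psi_l_smooth : smooth_on Omega Psi_l)
    (Psi_u_smooth : smooth_on Omega Psi_u)
    (Psi_l_gt0 : forall x, Omega x -> 0 < Psi_l x)
    (Psi_u_gt0 : forall x, Omega x -> 0 < Psi_u x)
    (Psi_l_sub : forall x, Omega x ->
       lam^-1 * peval q x * Psi_l x - Lop f B Sigma_eps Psi_l x <= 0)
    (Psi_l_boundary : forall x, data_boundary Omega x ->
       Psi_l x <= desirability_data phi lam x)
    (Psi_u_super : forall x, Omega x ->
       0 <= lam^-1 * peval q x * Psi_u x - Lop f B Sigma_eps Psi_u x)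
    (Psi_u_boundary : forall x, data_boundary Omega x ->
       desirability_data phi lam x <= Psi_u x) :
  forall x, Omega x ->
    Vstar x <= log_value lam Psi_l x /\ log_value lam Psi_u x <= Vstar x.
Proof.
move=> x Ox; have [Psistar_visc _ _] := Psistar_solution.
have F_increasing :=
  linear_operator_increasing f B Sigma_eps lam_gt0 q_posdef.
have le_l : Psi_l x <= Psistar x.
  exact: (classical_subsolution_le Omega_compact F_increasing Psistar_visc).
have le_u : Psistar x <= Psi_u x.
  exact: (classical_supersolution_ge Omega_compact F_increasing Psistar_visc).
have Psi_l_pos := Psi_l_gt0 x Ox.
rewrite Vstar_Psistar//; split; apply: ler_log_value => //; first exact: ltW.
- exact: ltW.
- exact: lt_le_trans Psi_l_pos le_l.
Qed.
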